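(* Let $0<n<1$ and $f\in D_{HK}$. The Abel integral equation $$\frac{1}{\Gamma(n)}\int_a^x(x-t)^{n-1}\varphi(t)\,dt=f(x)\qquad (a\le x\le b),$$ i.e. $\mathcal{J}_a^n\varphi=f$, has a solution $\varphi\in D_{HK}$ if and only if $\mathcal{J}_a^{1-n}f\in C[a,b]$ and $\mathcal{J}_a^{1-n}f(a)=0$.
   Context: Fix real numbers $a<b$. Let $C_0=\{F\in C[a,b]:F(a)=0\}$. A distribution $f$ on $(a,b)$ is Henstock–Kurzweil integrable if $f=F'$ (distributional derivative) for some (unique) $F\in C_0$; its integral is $\int_c^d f=F(d)-F(c)$. $D_{HK}$ is the space of these with the Alexiewicz norm $\|f\|_A=\sup_{[a,b]}|F|$; $L^1[a,b]$ is dense in it. Riemann–Liouville fractional integral on $D_{HK}$: for $m\ge1$, $\mathcal{J}_a^mf(x)=\frac{1}{\Gamma(m)}\int_a^x(x-t)^{m-1}f(t)\,dt$; for $0<m<1$, $\mathcal{J}_a^mf(x)=\frac{1}{\Gamma(m)}\lim_{k}\int_a^x(x-t)^{m-1}f_k(t)\,dt$ with $(f_k)\subset L^1[a,b]$, $\|f_k-f\|_A\to0$. In the Abel equation the left-hand side is understood as $\mathcal{J}_a^n\varphi$. *)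

(* Defs.v *)
From HB Require Import structures.
From mathcomp Require Import all_boot all_order all_algebra.
From mathcomp Require Import all_classical all_reals all_analysis.
Set Implicit Arguments. Unset Strict Implicit. Unset Printing Implicit Defensive.
Import Order.TTheory GRing.Theory Num.Theory.
Import numFieldNormedType.Exports.
Local Open Scope classical_set_scope.
Local Open Scope ring_scope.

(* Encoding: an element f of D_HK (a distribution on (a,b) with f = F',
   F in C_0) is represented by its unique primitive F in C_0.
   Two HK distributions are equal iff their primitives agree on [a,b]. *)

Section HK.
Variable R : realType.
Variables a b : R.

Notation mu := (@lebesgue_measure R).

Definition C0 (F : R -> R) : Prop :=
  {within `[a, b], continuous F} /\ F a = 0.

(* Alexiewicz norm of the HK distribution with primitive F: sup_[a,b] |F| *)
Definition alex (F : R -> R) : R := sup [set `|F x| | x in `[a, b]].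

Definition L1 (g : R -> R) : Prop := mu.-integrable `[a, b] (EFin \o g).

(* primitive x |-> int_a^x g (Lebesgue integral); for g in L^1 this is the
   element of C_0 representing g viewed as an HK distribution *)
Definition prim (g : R -> R) : R -> R := fun x => Rintegral mu `[a, x] g.

Definition Gamma (m : R) : R :=
  Rintegral mu `]0, +oo[ (fun t => t `^ (m - 1) * expR (- t)).

Definition RLint (m : R) (g : R -> R) : R -> R :=
  fun x => (Gamma m)^-1 * Rintegral mu `[a, x] (fun t => (x - t) `^ (m - 1) * g t).

(* RL_frac m F G : for 0 < m < 1, J_a^m f = g in D_HK, where F, G in C_0 are
   the primitives of f, g in D_HK.  Following the definition, J_a^m f is the
   limit (in the Alexiewicz norm) of J_a^m f_k, for any sequence (f_k) in L^1
   with ||f_k - f||_A -> 0. *)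
Definition RL_frac (m : R) (F G : R -> R) : Prop :=
  C0 G /\
  forall fk : nat -> R -> R,
    (forall k, L1 (fk k)) ->
    (fun k => alex (fun x => prim (fk k) x - F x)) @ \oo --> (0 : R) ->
    (fun k => alex (fun x => prim (RLint m (fk k)) x - G x)) @ \oo --> (0 : R).

End HK.

(* Main.v *)
Require Import Defs.
From HB Require Import structures.
From mathcomp Require Import all_boot all_order all_algebra.
From mathcomp Require Import ring lra.
From mathcomp Require Import all_classical all_reals all_analysis.
From mathcomp Require Import measurable_realfun.
Import Order.TTheory GRing.Theory Num.Theory.
Import numFieldNormedType.Exports.
Local Open Scope classical_set_scope.
Local Open Scope ring_scope.

(* On primitives, the fractional integral of order m acts as the classical
   Riemann-Liouville operator I^m: by Fubini, I^1 (I^m g) = I^m (I^1 g) for g in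
   L^1, I^m is bounded for the sup norm on [a, b], and L^1 is dense.  Hence
   J^m f = g holds in D_HK iff the primitives satisfy G = I^m F on [a, b].
   Since I^n I^(1-n) = c I^1 for a constant 0 < c < oo, F = I^n Phi gives
   I^(1-n) F = c' I^1 Phi; conversely I^(1-n) F = I^1 h gives
   c I^1 F = I^n I^1 h = I^1 (I^n h), hence c F = I^n h by continuity.
   As c can be absorbed in the solution, the value c = 1, that is, the Euler
   identity B(n, 1 - n) = Gamma(n) Gamma(1 - n), is never needed. *)

(** The obstacle is that [Rintegral] takes the finite part of an extended integral and so returns 0
    on divergence: no exchange of integrals is meaningful before finiteness is known. Kernels are
    therefore cut off so that all integrals run over the whole line, the convolution of two kernels
    is kept in the extended reals, and [fine] is taken at the end. By scaling, the kernels of orders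
    [p] and [q] convolve to a multiple of [(x - t) ^ (p + q - 1)]; the exponent vanishes exactly
    when [p + q = 1], and the composed operator is then plain integration up to a factor. That this
    factor is finite and nonzero follows from crude bounds on the Beta and Gamma integrals. On the
    distribution side, [RL_frac] quantifies over all approximating sequences, so it determines [G]
    only because such a sequence exists; moving averages provide one. *)

(** * Affine change of variables for Lebesgue measure *)

Section affine.
Context {R : realType}.
Local Notation mu := (@lebesgue_measure R).

Let affine (c d : R) : measurableTypeR R -> measurableTypeR R := fun x : R => c * x + d.

Let measurable_affine (c d : R) : measurable_fun [set: measurableTypeR R] (affine c d).
Proof. by apply: measurable_funD => //; apply: measurable_funM. Qed.

Let image_measure (c d : R) : {measure set (measurableTypeR R) -> \bar R}.
Proof.
pose nu : {measure set (measurableTypeR R) -> \bar R} := pushforward mu (affine c d).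
exact: (nu (measurable_affine c d)).
Defined.

Let scaled_image (c d : R) : {measure set (measurableTypeR R) -> \bar R} :=
  mscale (NngNum (normr_ge0 c)) (image_measure c d).

(** The right-hand side is the measure [scaled_image c d]; it agrees with [mu] on half-open
    intervals, and uniqueness of Lebesgue measure does the rest. *)
Lemma lebesgue_measure_affine (c d : R) (A : set R) : c != 0 -> measurable A ->
  (mu A = `|c|%:E * mu ((fun x => c * x + d)%R @^-1` A))%E.
Proof.
move=> c0 mA.
rewrite (@lebesgue_measure_unique _ (scaled_image c d)) //= => _ [[p q]] _ <-.
rewrite /scaled_image /= /mscale /= /pushforward /affine.
(* For [c < 0] the endpoints swap, and the preimage is closed on the left instead of on the
   right. *)
have pE : (fun x : R => c * x + d) @^-1` `]p, q]%classic =
   if 0 < c then `](p - d) / c, (q - d) / c]%classic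
   else `[(q - d) / c, (p - d) / c[%classic.
  case: ifPn => cp; apply/seteqP; split => x /=; rewrite !in_itv/=.
  - by rewrite ltr_pdivrMr// ler_pdivlMr// ltrBlDr lerBrDr mulrC.
  - by rewrite ltr_pdivrMr// ler_pdivlMr// ltrBlDr lerBrDr mulrC.
  - have cn : c < 0 by rewrite lt_neqAle c0 leNgt.
    by rewrite ler_ndivrMr// ltr_ndivlMr// ltrBlDr lerBrDr mulrC andbC.
  - have cn : c < 0 by rewrite lt_neqAle c0 leNgt.
    by rewrite ler_ndivrMr// ltr_ndivlMr// ltrBlDr lerBrDr mulrC andbC.
rewrite pE; case: ifPn => cp.
- rewrite !lebesgue_measure_itv/= !lte_fin ltr_pM2r ?invr_gt0// ltrD2r.
  case: ifPn => _; last by rewrite mule0.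
  rewrite gtr0_norm// -!EFinD -EFinM; congr EFin; field; exact: c0.
- have cn : c < 0 by rewrite lt_neqAle c0 leNgt.
  rewrite !lebesgue_measure_itv/= !lte_fin ltr_nM2r ?invr_lt0// ltrD2r.
  case: ifPn => _; last by rewrite mule0.
  rewrite ltr0_norm// -!EFinD -EFinM; congr EFin; field; exact: c0.
Qed.

Lemma ge0_integral_affine (c d : R) (f : R -> \bar R) : c != 0 ->
  measurable_fun [set: R] f -> (forall x, 0 <= f x)%E ->
  (\int[mu]_x f x = `|c|%:E * \int[mu]_x f (c * x + d)%R)%E.
Proof.
move=> c0 mf f0.
transitivity (\int[scaled_image c d]_x f x)%E.
  apply: eq_measure_integral => A mA _.
  exact: (lebesgue_measure_affine c d).
rewrite ge0_integral_mscale//=; congr (_ * _)%E.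
exact: (ge0_integral_pushforward (measurable_affine c d) mu measurableT mf).
Qed.

(** The integral is the difference of those of the positive and negative parts; each of them is an
    affine substitution of slope -1. *)
Lemma integral_reflection (d : R) (f : R -> \bar R) :
  measurable_fun [set: R] f ->
  (\int[mu]_x f x = \int[mu]_x f (d - x)%R)%E.
Proof.
move=> mf.
have refl (g : R -> \bar R) : measurable_fun [set: R] g -> (forall x, 0 <= g x)%E ->
    (\int[mu]_x g x = \int[mu]_x g (d - x)%R)%E.
  move=> mg g0; rewrite (ge0_integral_affine (-1) d)// ?oppr_eq0 ?oner_eq0//.
  rewrite normrN1 mul1e; apply: eq_integral => x _.
  by rewrite mulN1r addrC.
rewrite [LHS]integralE [RHS]integralE; congr (_ - _)%E.
- rewrite (refl _ (measurable_funepos mf))//; apply: eq_integral => x _.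
  by rewrite (funepos_comp f (fun x => d - x)).
- rewrite (refl _ (measurable_funeneg mf))//; apply: eq_integral => x _.
  by rewrite (funeneg_comp f (fun x => d - x)).
Qed.

End affine.

(** * Exchange of integrals for two kernels applied in succession *)

Section Fubini_kernels.
Context {R : realType}.
Local Notation mu := (@lebesgue_measure R).

(** A positive factor preserves infinite parts, hence also the convention for [+oo - +oo], while
    [r = 0] gives 0 on both sides. This matters for inner integrals that may diverge. *)
Lemma ge0_scale_integral (r : R) (f : R -> R) : 0 <= r ->
  measurable_fun [set: R] f ->
  (\int[mu]_x (r * f x)%:E = r%:E * \int[mu]_x (f x)%:E)%E.
Proof.
move=> r0 mf.
have posZ : (\int[mu]_x ((fun x => (r * f x)%:E)^\+ x) =
             r%:E * \int[mu]_x ((EFin \o f)^\+ x))%E.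
  rewrite -ge0_integralZl//; last exact/measurable_funepos/measurable_EFinP.
  by apply: eq_integral => x _; rewrite -(congr1 (@^~ x) (ge0_funeposM _ r0)).
have negZ : (\int[mu]_x ((fun x => (r * f x)%:E)^\- x) =
             r%:E * \int[mu]_x ((EFin \o f)^\- x))%E.
  rewrite -ge0_integralZl//; last exact/measurable_funeneg/measurable_EFinP.
  by apply: eq_integral => x _; rewrite -(congr1 (@^~ x) (ge0_funenegM _ r0)).
rewrite [LHS]integralE posZ negZ [in RHS]integralE.
move: r0; rewrite le_eqVlt => /predU1P[<-|r0]; first by rewrite !mul0e sube0.
case: (integral _ _ _) => [p| |]; case: (integral _ _ _) => [q| |] //=;
  rewrite ?gt0_muley ?gt0_muleNy ?lte_fin//=.
by rewrite -!EFinD -EFinM; congr EFin; ring.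
Qed.

Lemma ge0_fineMl (r : R) (y : \bar R) : 0 <= r -> fine (r%:E * y)%E = r * fine y.
Proof.
rewrite le_eqVlt => /predU1P[<-|r0]; first by rewrite mul0e mul0r.
by case: y => [y| |] //; rewrite ?gt0_muley ?gt0_muleNy ?lte_fin//= mulr0.
Qed.

(** Here the integral may be infinite and the factor, later a value of [g], may have either sign; a
    negative factor is handled through [- r]. *)
Lemma scale_ge0_integral (r : R) (f : R -> R) :
  (forall x, 0 <= f x) -> measurable_fun [set: R] f ->
  (\int[mu]_x (f x * r)%:E = \int[mu]_x (f x)%:E * r%:E)%E.
Proof.
move=> f0 mf; rewrite muleC.
have [r0|/ltW r0] := leP 0 r.
  by rewrite -ge0_scale_integral//; apply: eq_integral => x _; rewrite mulrC.
transitivity (- \int[mu]_x ((- r * f x)%:E))%E.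
  rewrite -integral_ge0N//; last first.
    by move=> x _; rewrite lee_fin mulr_ge0// oppr_ge0.
  by apply: eq_integral => x _ /=; rewrite mulNr opprK mulrC.
by rewrite ge0_scale_integral ?oppr_ge0// EFinN mulNe oppeK.
Qed.

(* The inner integral may diverge for s in a null set, where its finite part is
   the junk value 0. *)
Variables (k1 k2 g : R -> R) (x : R).
Hypotheses (mk1 : measurable_fun [set: R] k1) (mk2 : measurable_fun [set: R] k2).
Hypotheses (k1_ge0 : forall u, 0 <= k1 u) (k2_ge0 : forall u, 0 <= k2 u).
Hypothesis mg : measurable_fun [set: R] g.

Let W t := (\int[mu]_s (k1 (x - s) * k2 (s - t))%:E)%E.
Hypothesis Wg : (\int[mu]_t (W t * `|g t|%:E) < +oo)%E.

Let H (z : R * R) : \bar R := (k1 (x - z.1) * k2 (z.1 - z.2) * g z.2)%:E.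

Let mH : measurable_fun [set: R * R] H.
Proof.
apply/measurable_EFinP; apply: measurable_funM; last exact: measurableT_comp.
apply: measurable_funM; apply: measurableT_comp => //.
  by apply: measurable_funB.
by apply: measurable_funB.
Qed.

Let mkk t : measurable_fun [set: R] (fun s => k1 (x - s) * k2 (s - t)).
Proof.
apply: measurable_funM; apply: measurableT_comp => //.
  by apply: measurable_funB.
by apply: measurable_funB.
Qed.

Let mkg s : measurable_fun [set: R] (fun t => k2 (s - t) * g t).
Proof.
apply: measurable_funM => //; apply: measurableT_comp => //.
by apply: measurable_funB.
Qed.

Let kk_ge0 t s : 0 <= k1 (x - s) * k2 (s - t).
Proof. by rewrite mulr_ge0. Qed.

(** Tonelli with [s] innermost: the double integral of the absolute value of [H] is exactly the
    quantity bounded in [Wg]. *)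
Let iH : (mu \x mu)%E.-integrable [set: R * R] H.
Proof.
apply/integrable21ltyP => //; apply: le_lt_trans Wg.
rewrite le_eqVlt; apply/orP; left; apply/eqP; apply: eq_integral => t _.
rewrite /W -scale_ge0_integral//; apply: eq_integral => s _ /=.
by rewrite normrM (ger0_norm (kk_ge0 _ _)).
Qed.

(** Valid for every [s], divergent inner integrals included, because [fine] commutes with the factor
    [k1 (x - s)], which is nonnegative. *)
Let HF s : (k1 (x - s) * (\int[mu]_t (k2 (s - t) * g t)))%R =
  fine (fubini_F mu H s).
Proof.
rewrite /fubini_F /H /=.
under eq_integral do rewrite -mulrA.
by rewrite ge0_scale_integral// ge0_fineMl.
Qed.

Let iF := integrable_fubini_F iH.

Lemma integrable_iterated_kernels : mu.-integrable [set: R]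
  (fun s => (k1 (x - s) * (\int[mu]_t (k2 (s - t) * g t)))%:E)%R.
Proof.
apply: le_integrable iF => //.
  apply/measurable_EFinP; rewrite (funext HF).
  apply: measurableT_comp => //; exact: measurable_int iF.
(* Taking the finite part never increases the absolute value, so the Fubini marginal dominates. *)
have fine_le (y : \bar R) : (`|(fine y)%:E| <= `|y|)%E.
  by case: y => [r| |] //=; rewrite leey.
by move=> s _; rewrite HF; exact: fine_le.
Qed.

Lemma integral_iterated_kernels :
  (\int[mu]_s ((k1 (x - s) * (\int[mu]_t (k2 (s - t) * g t)))%R)%:E =
   \int[mu]_t (W t * (g t)%:E))%E.
Proof.
(* The marginal is integrable, hence finite almost everywhere, and there [fine] loses nothing. *)
transitivity (\int[mu]_s (fubini_F mu H s))%E.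
  apply: ae_eq_integral => //.
  - exact: measurable_int integrable_iterated_kernels.
  - exact: measurable_int iF.
  - have := integrable_ae measurableT iF; apply: filterS => s /= /(_ I) Fs _.
    by rewrite HF fineK.
rewrite /fubini_F (Fubini iH); apply: eq_integral => t _.
by rewrite /W -scale_ge0_integral.
Qed.

End Fubini_kernels.

(** * The power kernel, its integrability, and convolutions of two kernels *)

Section kernel.
Context {R : realType}.
Local Notation mu := (@lebesgue_measure R).

(* The cut-off is needed because x `^ p = 1 for x < 0; note also that
   0 `^ (m - 1) = 0 unless m = 1. *)
Definition kern (m u : R) : R := if 0 <= u then u `^ (m - 1) else 0.

Lemma kern_patch m : kern m = (fun u : R => u `^ (m - 1)) \_ `[0, +oo[.
Proof.
by apply/funext => u; rewrite /kern patchE mem_setE in_itv/= andbT.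
Qed.

Lemma kern_ge0 m u : 0 <= kern m u.
Proof. by rewrite /kern; case: ifP => // _; exact: powR_ge0. Qed.

Lemma measurable_kern m : measurable_fun [set: R] (kern m).
Proof.
rewrite kern_patch; apply/(measurable_restrictT _ (measurable_itv _)).
apply: measurable_funTS; exact: measurable_powR.
Qed.

Lemma kern_lt0 m u : u < 0 -> kern m u = 0.
Proof. by move=> u0; rewrite /kern leNgt u0. Qed.

Lemma kern_powR m u : 0 <= u -> kern m u = u `^ (m - 1).
Proof. by move=> u0; rewrite /kern u0. Qed.

Lemma kern1 u : 0 <= u -> kern 1 u = 1.
Proof. by move=> u0; rewrite kern_powR// subrr powRr0. Qed.

Lemma kernM m r u : 0 < r -> kern m (r * u) = r `^ (m - 1) * kern m u.
Proof.
move=> r0; rewrite /kern pmulr_rge0//.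
by case: ifPn => u0; rewrite ?mulr0// powRM// ltW.
Qed.

Lemma continuous_powR_gt0 (p x : R) : 0 < x -> {for x, continuous (fun u : R => u `^ p)}.
Proof.
move=> x0; apply: differentiable_continuous; apply/derivable1_diffP.
by apply: derivable_powR; rewrite in_itv/= x0.
Qed.

(** The antiderivative is [x ^ m / m]. The bound is uniform in [e], which permits the passage to
    [e = 0]. *)
Lemma integral_powR_le (m e d : R) : 0 < m -> 0 < e -> e < d ->
  (\int[mu]_(x in `[e, d]) (x `^ (m - 1))%:E <= (d `^ m / m)%:E)%E.
Proof.
move=> m0 e0 ed.
rewrite (@continuous_FTC2 _ (fun x : R => x `^ (m - 1)) (fun x : R => x `^ m / m))//.
- rewrite -EFinB lee_fin gerBl divr_ge0 ?powR_ge0// ltW//.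
- apply: continuous_in_subspaceT => x; rewrite inE/= in_itv/= => /andP[ex _].
  by apply: continuous_powR_gt0; exact: lt_le_trans ex.
- have cF (x : R) : 0 < x -> {for x, continuous (fun y : R => y `^ m / m)}.
    by move=> x0; apply: cvgM; [exact: continuous_powR_gt0|exact: cvg_cst].
  split.
  + move=> x; rewrite in_itv/= => /andP[ex _].
    apply: derivableM => //; apply: derivable_powR.
    by rewrite in_itv/= andbT (lt_trans e0).
  + by apply: cvg_at_right_filter; exact: cF.
  + by apply: cvg_at_left_filter; apply: cF; exact: lt_trans ed.
- move=> x; rewrite in_itv/= => /andP[ex _].
  have x0 : 0 < x by exact: lt_trans ex.
  rewrite derive1E deriveM//; last by apply: derivable_powR; rewrite in_itv/= x0.
  rewrite derive_cst scaler0 add0r.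
  have [_ ->] := is_derive1_powR m x0.
  by rewrite /GRing.scale/= mulrA mulVf ?mul1r// gt_eqF.
Qed.

Lemma integral_kern_lty (m d : R) : 0 < m -> 0 < d ->
  (\int[mu]_(x in `[0%R, d]) (kern m x)%:E < +oo)%E.
Proof.
move=> m0 d0.
rewrite -integral_itv_obnd_cbnd; last first.
  by apply/measurable_EFinP; apply: measurable_funTS; exact: measurable_kern.
(* Monotone convergence along intervals avoiding the singularity at 0; the index [k.+2] keeps the
   left endpoint strictly below [d]. *)
pose E (k : nat) := `[d / k.+2%:R, d]%classic.
have dk k : 0 < d / k.+2%:R by rewrite divr_gt0.
have UE : `]0, d]%classic = \bigcup_k E k.
  apply/seteqP; split => x /=; rewrite in_itv/=.
    move=> /andP[x0 xd].
    have [k kx] : exists k : nat, d / x < k%:R by exists (Num.truncn (d / x)).+1; exact: truncnS_gt.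
    exists k => //; rewrite /E/= in_itv/= xd andbT ler_pdivrMr// mulrC -ler_pdivrMr//.
    by rewrite (le_trans (ltW kx))// ler_nat -addn2 leq_addr.
  move=> [k _]; rewrite /E/= in_itv/= => /andP[kx ->].
  by rewrite (lt_le_trans _ kx).
rewrite UE.
apply: (@le_lt_trans _ _ (d `^ m / m)%:E); last by rewrite ltry.
have cE : (\int[mu]_(x in E i) (kern m x)%:E @[i --> \oo] -->
    \int[mu]_(x in \bigcup_i E i) (kern m x)%:E)%E.
  apply: ge0_nondecreasing_set_cvg_integral.
  - apply/nondecreasing_seqP => k; rewrite subsetEset => x; rewrite /E/= !in_itv/=.
    move=> /andP[kx ->]; rewrite andbT (le_trans _ kx)//.
    by rewrite ler_pM2l// lef_pV2 ?posrE// ler_nat.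
  - by move=> k; exact: measurable_itv.
  - by move=> k; apply/measurable_EFinP; apply: measurable_funTS; exact: measurable_kern.
  - by move=> k x _; rewrite lee_fin kern_ge0.
apply: cvge_le cE; apply: nearW => k.
have kd : d / k.+2%:R < d by rewrite ltr_pdivrMr// ltr_pMr// ltr1n.
apply: le_trans (integral_powR_le m _ d m0 (dk k) kd).
rewrite le_eqVlt; apply/orP; left; apply/eqP; apply: eq_integral => x.
rewrite inE /E/= in_itv/= => /andP[kx _]; rewrite kern_powR//.
by rewrite (le_trans _ kx)// ltW.
Qed.

(** At [x = 1], [t = 0] this is the Beta integral of [p] and [q]. It is extended-valued because its
    finiteness is established separately. *)
Definition kernel_conv (p q x t : R) : \bar R :=
  (\int[mu]_s (kern p (x - s) * kern q (s - t))%:E)%E.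

Let measurable_kern_comp p (f : R -> R) : measurable_fun [set: R] f ->
  measurable_fun [set: R] (fun s => kern p (f s)).
Proof. by move=> mf; apply: measurableT_comp => //; exact: measurable_kern. Qed.

Let measurable_kernel_conv p q x t :
  measurable_fun [set: R] (fun s => kern p (x - s) * kern q (s - t)).
Proof.
apply: measurable_funM; apply: measurable_kern_comp.
  exact: measurable_funB.
exact: measurable_funB.
Qed.

(** The reflection of [s] to [x + t - s] swaps [x - s] and [s - t]. *)
Lemma kernel_convC p q x t : kernel_conv p q x t = kernel_conv q p x t.
Proof.
rewrite /kernel_conv (integral_reflection (x + t)); last first.
  by apply/measurable_EFinP; exact: measurable_kernel_conv.
by apply: eq_integral => s _; rewrite mulrC; congr (kern _ _ * kern _ _)%:E; ring.
Qed.

Lemma kernel_conv_ge0 p q x t : (0 <= kernel_conv p q x t)%E.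
Proof. by apply: integral_ge0 => s _; rewrite lee_fin mulr_ge0// kern_ge0. Qed.

Lemma integral_restrict_kern m d :
  (\int[mu]_(x in `[0%R, d]) (kern m x)%:E =
   \int[mu]_x (if (x <= d)%R then kern m x else 0%R)%:E)%E.
Proof.
rewrite integral_mkcond; apply: eq_integral => x _.
rewrite patchE mem_setE in_itv/=.
by case: (leP 0 x) => [x0|x0]/=; [case: ifP|rewrite kern_lt0//; case: ifP].
Qed.

(** [kern 1] is the indicator of the half-line, so the shift [s = v + t] leaves [kern m v] cut off
    at [v <= x - t]. *)
Lemma kernel_conv1_le m x t d : x - t <= d ->
  (kernel_conv 1 m x t <= \int[mu]_(v in `[0%R, d]) (kern m v)%:E)%E.
Proof.
move=> xtd; rewrite integral_restrict_kern /kernel_conv.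
rewrite (ge0_integral_affine 1 t) ?oner_eq0//; last 2 first.
- by apply/measurable_EFinP; exact: measurable_kernel_conv.
- by move=> s; rewrite lee_fin mulr_ge0// kern_ge0.
rewrite normr1 mul1e; apply: ge0_le_integral => //.
- by move=> s _; rewrite lee_fin mulr_ge0// kern_ge0.
- apply/measurable_EFinP; apply: measurable_funM; apply: measurable_kern_comp.
    by apply: measurable_funB => //; apply: measurable_funD => //; exact: measurable_funM.
  by apply: measurable_funB => //; apply: measurable_funD => //; exact: measurable_funM.
- apply/measurable_EFinP; apply: measurable_fun_ifT => //.
    exact: measurable_fun_ler.
  exact: measurable_kern.
- move=> v _; rewrite lee_fin mul1r addrK.
  have [xv|xv] := ltP (x - (v + t)) 0.
    by rewrite kern_lt0// mul0r; case: ifP => // _; exact: kern_ge0.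
  rewrite kern1// mul1r ifT//; lra.
Qed.

(** Substitute [s = (x - t) * w + t]: the two kernels contribute the exponents [p - 1] and [q - 1],
    the Jacobian one more. *)
Lemma kernel_conv_scale p q x t : t < x ->
  kernel_conv p q x t = (((x - t) `^ (p + q - 1))%:E * kernel_conv p q 1 0)%E.
Proof.
move=> tx; have xt0 : 0 < x - t by rewrite subr_gt0.
rewrite /kernel_conv [LHS](ge0_integral_affine (x - t) t); last 3 first.
- by rewrite gt_eqF.
- by apply/measurable_EFinP; exact: measurable_kernel_conv.
- by move=> s; rewrite lee_fin mulr_ge0// kern_ge0.
rewrite (gtr0_norm xt0) -[RHS]ge0_scale_integral; last 2 first.
- by apply: powR_ge0.
- exact: measurable_kernel_conv.
rewrite -[LHS]ge0_scale_integral; last 2 first.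
- exact: ltW.
- apply: measurable_funM; apply: measurable_kern_comp.
    by apply: measurable_funB => //; apply: measurable_funD => //; exact: measurable_funM.
  by apply: measurable_funB => //; apply: measurable_funD => //; exact: measurable_funM.
apply: eq_integral => w _; congr EFin.
rewrite subr0 (_ : x - ((x - t) * w + t) = (x - t) * (1 - w)); last by ring.
rewrite addrK !kernM// (_ : p + q - 1 = 1 + ((p - 1) + (q - 1))); last by ring.
have xtD r s : (x - t) `^ (r + s) = (x - t) `^ r * (x - t) `^ s.
  by apply: powRD; apply/implyP => _; rewrite gt_eqF.
rewrite (xtD 1) (xtD (p - 1) (q - 1)) powRr1 ?ltW//.
by ring.
Qed.

(** Only [s = x] could contribute, and there [kern p 0 = 0] since [p - 1] is nonzero. *)
Lemma kernel_conv_refl p q x : 0 < p < 1 -> kernel_conv p q x x = 0%E.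
Proof.
move=> /andP[p0 p1]; rewrite /kernel_conv integral0_eq// => s _; congr EFin.
have [xs|xs|->] := ltgtP x s.
- by rewrite kern_lt0 ?mul0r// subr_lt0.
- by rewrite mulrC kern_lt0 ?mul0r// subr_lt0.
- by rewrite kern_powR ?subrr// powR0 ?mul0r// subr_eq0 lt_eqF.
Qed.

Lemma kernel_conv_lt p q x t : x < t -> kernel_conv p q x t = 0%E.
Proof.
move=> xt; rewrite /kernel_conv integral0_eq// => s _; congr EFin.
have [xs|xs] := ltP x s.
- by rewrite kern_lt0 ?mul0r// subr_lt0.
- by rewrite mulrC kern_lt0 ?mul0r// subr_lt0 (le_lt_trans xs).
Qed.

End kernel.

(** * Finiteness and positivity of the Beta and Gamma integrals *)

Section constants.
Context {R : realType}.
Local Notation mu := (@lebesgue_measure R).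

Let kern_upto (m d v : R) := if v <= d then kern m v else 0.

Let measurable_kern_upto m d : measurable_fun [set: R] (kern_upto m d).
Proof.
apply: measurable_fun_ifT => //; first exact: measurable_fun_ler.
exact: measurable_kern.
Qed.

Let kern_upto_ge0 m d v : 0 <= kern_upto m d v.
Proof. by rewrite /kern_upto; case: ifP => // _; exact: kern_ge0. Qed.

Let integral_kern_upto_lty m d : 0 < m -> 0 < d ->
  (\int[mu]_v (kern_upto m d v)%:E < +oo)%E.
Proof. by move=> m0 d0; rewrite -integral_restrict_kern integral_kern_lty. Qed.

Lemma kern_le2 (m u : R) : 0 < m < 1 -> 2^-1 <= u -> kern m u <= 2.
Proof.
move=> /andP[m0 m1] u2; have u0 : 0 < u by rewrite (lt_le_trans _ u2)// invr_gt0.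
rewrite kern_powR ?(ltW u0)//; have [u1|/ltW u1] := leP u 1.
  apply: (@le_trans _ _ (u `^ (- 1))).
    by apply: ger_powR; [rewrite u0|lra].
  by rewrite powR_inv1 ?(ltW u0)// -[leRHS]invrK lef_pV2 ?posrE// invr_gt0.
apply: (@le_trans _ _ (u `^ 0)); last by rewrite powRr0 ler1n.
by apply: ler_powR => //; lra.
Qed.

Lemma powR_ge1 (m u : R) : m < 1 -> 0 < u <= 1 -> 1 <= u `^ (m - 1).
Proof.
move=> m1 u01; apply: (@le_trans _ _ (u `^ 0)); first by rewrite powRr0.
by apply: ger_powR => //; lra.
Qed.

(** On [[0, 1]] one of [s] and [1 - s] is at least 1/2, so its kernel is at most 2 by [kern_le2];
    the product is then at most twice the sum of the two kernels, each of which is integrable. *)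
Lemma kernel_conv01_lty (p q : R) : 0 < p < 1 -> 0 < q < 1 -> (kernel_conv p q 1 0 < +oo :> \bar R)%E.
Proof.
move=> p01 q01.
have m1 : measurable_fun [set: R] (fun s => kern_upto p 1 (1 - s)).
  apply: measurableT_comp; first exact: measurable_kern_upto.
  exact: measurable_funB.
have m2 := measurable_kern_upto q 1.
apply: (@le_lt_trans _ _ (\int[mu]_s ((kern_upto p 1 (1 - s))%:E + (kern_upto q 1 s)%:E) * 2%:E)%E).
  rewrite -ge0_integralZr//; last first.
  - by move=> s _; rewrite adde_ge0// lee_fin.
  - by apply: emeasurable_funD; exact/measurable_EFinP.
  apply: ge0_le_integral => //.
  - by move=> s _; rewrite lee_fin mulr_ge0// kern_ge0.
  - apply/measurable_EFinP; apply: measurable_funM;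
      apply: measurableT_comp; rewrite ?subr0; try exact: measurable_kern;
      exact: measurable_funB.
  - apply/emeasurable_funM => //.
    by apply: emeasurable_funD; exact/measurable_EFinP.
  move=> s _; rewrite -EFinD -EFinM lee_fin subr0.
  have [s0|s0] := ltP s 0.
    by rewrite (kern_lt0 q)// mulr0 mulr_ge0// addr_ge0.
  have [s1|s1] := ltP 1 s.
    by rewrite (kern_lt0 p) ?subr_lt0// mul0r mulr_ge0// addr_ge0.
  rewrite /kern_upto gerBl s0 s1 mulrDl.
  have [s2|s2] := leP 2^-1 s.
    rewrite ler_wpDr ?mulr_ge0 ?kern_ge0//.
    by rewrite ler_wpM2l ?kern_ge0// kern_le2.
  rewrite ler_wpDl ?mulr_ge0 ?kern_ge0// mulrC.
  by rewrite ler_wpM2l ?kern_ge0// kern_le2//; lra.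
rewrite ge0_integralD//; last 4 first.
- by move=> s _; rewrite lee_fin.
- exact/measurable_EFinP.
- by move=> s _; rewrite lee_fin.
- exact/measurable_EFinP.
rewrite lte_mul_pinfty//.
- by rewrite adde_ge0// integral_ge0// => s _; rewrite lee_fin.
- rewrite ge0_fin_numE; last by rewrite adde_ge0// integral_ge0// => s _; rewrite lee_fin.
  rewrite lte_add_pinfty//.
    rewrite -(integral_reflection 1 (fun s => (kern_upto p 1 s)%:E)); last exact/measurable_EFinP.
    by apply: integral_kern_upto_lty => //; case/andP: p01.
  by apply: integral_kern_upto_lty => //; case/andP: q01.
- by rewrite ltry.
Qed.

(** Both exponents are negative, so both factors are at least 1 inside the unit interval. The
    endpoints are excluded because a kernel takes the value 0 there. *)
Lemma kernel_conv01_ge1 (p q : R) : 0 < p < 1 -> 0 < q < 1 -> (1 <= kernel_conv p q 1 0 :> \bar R)%E.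
Proof.
move=> /andP[p0 p1] /andP[q0 q1].
have -> : 1%E = (\int[mu]_s (\1_(`]0%R, 1%R[%classic : set R) s)%:E)%E.
  by rewrite integral_indic// setIT [RHS]lebesgue_measure_itv/= lte_fin ltr01 oppr0 adde0.
apply: ge0_le_integral => //.
- by apply/measurable_EFinP; exact: measurable_indic.
- apply/measurable_EFinP; apply: measurable_funM;
      apply: measurableT_comp; try exact: measurable_kern;
      exact: measurable_funB.
move=> s _; rewrite lee_fin indicE mem_setE in_itv/=.
have [/andP[s0 s1]|_] := boolP (_ && _); last by rewrite mulr_ge0// kern_ge0.
rewrite subr0 !kern_powR ?subr_ge0 ?(ltW s0) ?(ltW s1)// -[leLHS]mulr1.
by apply: ler_pM => //; apply: powR_ge1 => //; lra.
Qed.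

(** An infinite integral would have finite part 0, so both bounds matter. The integrand is at least
    [expR (- 1)] on []0, 1]]; it is at most [t ^ (m - 1)] there and at most the exponential density
    beyond 1. *)
Lemma Gamma_gt0 (m : R) : 0 < m < 1 -> 0 < Gamma m :> R.
Proof.
move=> /andP[m0 m1]; rewrite /Gamma /Rintegral fine_gt0//.
set f := fun t : R => t `^ (m - 1) * expR (- t).
have f0 t : 0 <= f t by rewrite mulr_ge0 ?powR_ge0 ?expR_ge0.
have mf : measurable_fun [set: R] f.
  apply: measurable_funM; first exact: measurable_powR.
  by apply: measurableT_comp => //; exact: measurable_funN.
have mexp : measurable_fun [set: R] (exponential_pdf (1 : R)) by exact: measurable_exponential_pdf.
apply/andP; split.
- apply: (@lt_le_trans _ _ (\int[mu]_(t in `]0%R, 1%R]) (expR (- 1))%:E)%E).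
    rewrite integral_cst//= lebesgue_measure_itv/= lte_fin ltr01 oppr0 adde0 mule1.
    by rewrite lte_fin expR_gt0.
  apply: (@le_trans _ _ (\int[mu]_(t in `]0%R, 1%R]) (f t)%:E)%E).
    apply: ge0_le_integral => //.
    + by apply/measurable_EFinP; exact: measurable_funTS.
    + move=> t /=; rewrite in_itv/= => /andP[t0 t1]; rewrite lee_fin /f.
      rewrite -[leLHS]mul1r ler_pM//; first by apply: powR_ge1 => //; rewrite t0.
      by rewrite ler_expR lerN2.
  apply: ge0_subset_integral => //.
  + by apply/measurable_EFinP; exact: measurable_funTS.
  + by move=> t _; rewrite lee_fin.
  + by move=> t /=; rewrite !in_itv/= andbT => /andP[].
- rewrite integral_mkcond.
  apply: (@le_lt_trans _ _ (\int[mu]_t ((kern_upto m 1 t)%:E + (exponential_pdf 1 t)%:E))%E).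
    apply: ge0_le_integral => //.
    + by move=> t _; rewrite patchE; case: ifP => // _; rewrite lee_fin f0.
    + apply/(measurable_restrictT _ (measurable_itv _)).
      by apply/measurable_EFinP; exact: measurable_funTS.
    + by apply: emeasurable_funD; apply/measurable_EFinP; [exact: measurable_kern_upto|exact: mexp].
    move=> t _; rewrite patchE mem_setE in_itv/= andbT.
    case: ifPn => [t0|_]; last by rewrite adde_ge0// lee_fin// exponential_pdf_ge0.
    rewrite -EFinD lee_fin (exponential_pdfE 1 (ltW t0)) mul1r mulN1r /kern_upto.
    have [t1|t1] := leP t 1.
      rewrite ler_wpDr ?expR_ge0// kern_powR ?(ltW t0)// ler_piMr ?powR_ge0//.
      by rewrite expR_le1 oppr_le0 ltW.
    rewrite add0r ler_piMl ?expR_ge0//.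
    apply: (@le_trans _ _ (t `^ 0)); last by rewrite powRr0.
    by apply: ler_powR; [exact: ltW|lra].
  rewrite ge0_integralD//; last 4 first.
  + by move=> t _; rewrite lee_fin.
  + by apply/measurable_EFinP; exact: measurable_kern_upto.
  + by move=> t _; rewrite lee_fin exponential_pdf_ge0.
  + exact/measurable_EFinP.
  by rewrite integral_exponential_pdf// lte_add_pinfty ?ltry// integral_kern_upto_lty.
Qed.

End constants.

(** * Composition of Riemann-Liouville operators on integrable functions *)

Section fractional_integral.
Context {R : realType}.
Local Notation mu := (@lebesgue_measure R).
Variables (a b : R).
Hypothesis ab : a < b.

Definition rl_conv (m : R) (g : R -> R) (x : R) : R :=
  \int[mu]_(t in `[a, x]) ((x - t) `^ (m - 1) * g t).

Lemma prim_rl_conv (g : R -> R) x : prim a g x = rl_conv 1 g x.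
Proof.
by apply: eq_Rintegral => t _; rewrite subrr powRr0 mul1r.
Qed.

(** The cut-off in [kern] encodes [t <= x] and the restriction of [g] encodes [a <= t], which turns
    the moving interval into the whole line. *)
Lemma rl_convE m (g : R -> R) x : x <= b ->
  rl_conv m g x = \int[mu]_t (kern m (x - t) * (g \_ `[a, b]) t).
Proof.
move=> xb; rewrite /rl_conv Rintegral_mkcond; apply: eq_Rintegral => t _.
rewrite !patchE !mem_setE !in_itv/=.
have [at_|ta] := leP a t => /=; last by rewrite mulr0.
have [tx|xt] := leP t x; last by rewrite kern_lt0 ?mul0r// subr_lt0.
by rewrite (le_trans tx xb) kern_powR ?subr_ge0.
Qed.

(** The factor [r] allows the inner operator to be [RLint], with [r] the inverse of [Gamma m2], or
    [prim], with [r = 1]. *)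
Lemma rl_conv_comp (m1 m2 r : R) (g : R -> R) (x : R) : a <= x <= b ->
  measurable_fun `[a, b] g ->
  (\int[mu]_t (kernel_conv m1 m2 x t * `|(g \_ `[a, b]) t|%:E) < +oo)%E ->
  rl_conv m1 (fun s => r * rl_conv m2 g s) x =
  r * fine (\int[mu]_t (kernel_conv m1 m2 x t * ((g \_ `[a, b]) t)%:E))%E.
Proof.
move=> /andP[ax xb] mg cg.
have mg' : measurable_fun [set: R] (g \_ `[a, b]).
  by apply/(measurable_restrictT _ (measurable_itv _)).
have igk := integrable_iterated_kernels _ _ _ _ (measurable_kern m1) (measurable_kern m2)
  (kern_ge0 m1) (kern_ge0 m2) mg' cg.
rewrite rl_convE//.
transitivity (\int[mu]_s (r * (kern m1 (x - s) *
    \int[mu]_t (kern m2 (s - t) * (g \_ `[a, b]) t)))).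
  apply: eq_Rintegral => s _; rewrite patchE mem_setE in_itv/=.
  have [xs|sx] := ltP x s; first by rewrite kern_lt0 ?mul0r ?mulr0// subr_lt0.
  rewrite (le_trans sx xb) andbT; have [as_|sa] := leP a s.
    by rewrite rl_convE ?(le_trans sx)// mulrCA.
  (* For [s < a] the inner integral vanishes: the kernel forces [t <= s], and the restricted [g] is
     0 below [a]. *)
  rewrite mulr0 [X in _ = _ * (_ * X)](_ : _ = 0) ?mulr0//.
  rewrite /Rintegral integral0_eq// => t _; congr EFin.
  rewrite patchE mem_setE in_itv/=; have [at_|ta] := leP a t => /=; last by rewrite mulr0.
  by rewrite kern_lt0 ?mul0r// subr_lt0 (lt_le_trans sa).
rewrite RintegralZl//; congr (_ * fine _).
by rewrite (integral_iterated_kernels _ _ _ _ (measurable_kern m1) (measurable_kern m2)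
  (kern_ge0 m1) (kern_ge0 m2) mg' cg).
Qed.

Lemma L1_restrict (g : R -> R) : L1 a b g ->
  measurable_fun `[a, b] g /\ (\int[mu]_t `|(g \_ `[a, b]) t|%:E < +oo)%E.
Proof.
move=> /integrableP[/measurable_EFinP mg ig]; split => //.
apply: le_lt_trans ig; rewrite le_eqVlt; apply/orP; left; apply/eqP.
rewrite [RHS]integral_mkcond; apply: eq_integral => t _.
by rewrite !patchE; case: ifP; rewrite //= normr0.
Qed.

(** Tonelli's condition for a bounded weight. The bound is asked only for [a <= t], since the
    restricted [g] vanishes below [a] and [kernel_conv 1 m x t] is bounded by [kern_mass m] only
    from there on. *)
Let conv_lty (W : R -> \bar R) (P : R) g : L1 a b g ->
  measurable_fun [set: R] W -> (forall t, 0 <= W t)%E ->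
  (forall t, a <= t -> (W t <= P%:E)%E) ->
  (\int[mu]_t (W t * `|(g \_ `[a, b]) t|%:E) < +oo)%E.
Proof.
move=> /L1_restrict[mg ig] mW W0 WP.
have mg' : measurable_fun [set: R] (fun t => `|(g \_ `[a, b]) t|%:E).
  apply/measurable_EFinP; apply: measurableT_comp => //.
  by apply/(measurable_restrictT _ (measurable_itv _)).
apply: (@le_lt_trans _ _ (\int[mu]_t (P%:E * `|(g \_ `[a, b]) t|%:E))%E).
  apply: ge0_le_integral => //.
  - by move=> t _; rewrite mule_ge0// lee_fin.
  - exact: emeasurable_funM.
  - exact: emeasurable_funM.
  move=> t _; have [at_|ta] := leP a t; first by rewrite lee_wpmul2r ?lee_fin// WP.
  by rewrite patchE mem_setE in_itv/= (lt_geF ta)/= normr0 !mule0.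
have P0 : (0 <= P%:E)%E by exact: le_trans (W0 a) (WP a _).
by rewrite ge0_integralZl// lte_mul_pinfty.
Qed.

Lemma measurable_kernel_conv p q x : measurable_fun [set: R] (kernel_conv p q x : R -> \bar R).
Proof.
pose f (z : R * R) := (kern p (x - z.1) * kern q (z.1 - z.2))%:E.
have mf : measurable_fun [set: R * R] f.
  apply/measurable_EFinP; apply: measurable_funM; apply: measurableT_comp;
    try exact: measurable_kern; exact: measurable_funB.
have f0 z : (0 <= f z)%E by rewrite lee_fin mulr_ge0// kern_ge0.
exact: (@measurable_fun_fubini_tonelli_G _ _ _ _ _ mu f mf f0).
Qed.

(** For [m > 0] this is [(b - a) ^ m / m], a bound for [rl_conv a m] in the sup norm on [[a, b]]. *)
Definition kern_mass (m : R) : R := \int[mu]_(v in `[0, b - a]) kern m v.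

Lemma kern_massE m : 0 < m ->
  (\int[mu]_(v in `[0%R, (b - a)%R]) (kern m v)%:E = (kern_mass m)%:E)%E.
Proof.
move=> m0; rewrite /kern_mass /Rintegral fineK// ge0_fin_numE.
  by rewrite integral_kern_lty ?subr_gt0.
by apply: integral_ge0 => v _; rewrite lee_fin kern_ge0.
Qed.

(** Both sides integrate [g] against a convolution of [kern 1] and [kern m], taken in opposite
    orders. *)
Lemma prim_RLint (m : R) (g : R -> R) (x : R) : 0 < m -> L1 a b g -> a <= x <= b ->
  prim a (RLint a m g) x = RLint a m (prim a g) x.
Proof.
move=> m0 g1 /[dup] axb /andP[ax xb].
have mg := (L1_restrict _ g1).1.
have c1 : (\int[mu]_t (kernel_conv 1 m x t * `|(g \_ `[a, b]) t|%:E) < +oo)%E.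
  apply: (conv_lty _ (kern_mass m)) => //; first exact: measurable_kernel_conv.
    by move=> t; exact: kernel_conv_ge0.
  by move=> t at_; rewrite -kern_massE// kernel_conv1_le// lerB.
rewrite prim_rl_conv (rl_conv_comp 1 m _ g x axb mg c1) /RLint -/(rl_conv m (prim a g) x).
congr (_ * _); transitivity (rl_conv m (fun s => 1 * rl_conv 1 g s) x); last first.
  by apply: eq_Rintegral => s _; rewrite mul1r -prim_rl_conv.
have c2 : (\int[mu]_t (kernel_conv m 1 x t * `|(g \_ `[a, b]) t|%:E) < +oo)%E.
  apply: le_lt_trans c1; rewrite le_eqVlt; apply/orP; left; apply/eqP.
  by apply: eq_integral => t _; rewrite kernel_convC.
rewrite (rl_conv_comp m 1 1 g x axb mg c2) mul1r.
apply: (congr1 fine); apply: eq_integral => t _.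
by rewrite (kernel_convC 1 m).
Qed.

Let kernel_conv_inv (n x t : R) : 0 < n < 1 ->
  kernel_conv n (1 - n) x t = if t < x then kernel_conv n (1 - n) 1 0 else 0%E.
Proof.
move=> n01; case: ltgtP => [tx|xt|->].
- rewrite kernel_conv_scale// (_ : n + (1 - n) - 1 = 0) ?powRr0 ?mul1e//; ring.
- exact: kernel_conv_lt.
- exact: kernel_conv_refl.
Qed.

Definition abel_constant (n : R) : R :=
  (Gamma n)^-1 * (Gamma (1 - n))^-1 * fine (kernel_conv n (1 - n) 1 0).

Let onem_01 (n : R) : 0 < n < 1 -> 0 < 1 - n < 1.
Proof. by move=> /andP[n0 n1]; rewrite subr_gt0 n1 ltrBlDr ltrDl. Qed.

Let beta_fin (n : R) : 0 < n < 1 -> kernel_conv n (1 - n) 1 0 \is a fin_num.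
Proof.
by move=> n01; rewrite ge0_fin_numE ?kernel_conv_ge0// kernel_conv01_lty// onem_01.
Qed.

Lemma abel_constant_gt0 (n : R) : 0 < n < 1 -> 0 < abel_constant n.
Proof.
move=> n01; rewrite !mulr_gt0 ?invr_gt0 ?Gamma_gt0 ?onem_01//.
rewrite (@lt_le_trans _ _ 1)// -lee_fin fineK ?beta_fin//.
by rewrite kernel_conv01_ge1// onem_01.
Qed.

Lemma RLint_RLint (n : R) (g : R -> R) (x : R) : 0 < n < 1 -> L1 a b g -> a <= x <= b ->
  RLint a n (RLint a (1 - n) g) x = abel_constant n * prim a g x.
Proof.
move=> n01 g1 /[dup] axb /andP[ax xb].
have mg := (L1_restrict _ g1).1.
have bf := beta_fin n n01.
set c := fine (kernel_conv n (1 - n) 1 0).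
have cE : kernel_conv n (1 - n) 1 0 = c%:E by rewrite fineK.
have c1 : (\int[mu]_t (kernel_conv n (1 - n) x t * `|(g \_ `[a, b]) t|%:E) < +oo)%E.
  apply: (conv_lty _ c) => //; first exact: measurable_kernel_conv.
    by move=> t; exact: kernel_conv_ge0.
  move=> t at_; rewrite kernel_conv_inv//; case: ifPn => _; first by rewrite cE.
  by rewrite -cE kernel_conv_ge0.
rewrite {1}/RLint -/(rl_conv n (RLint a (1 - n) g) x).
rewrite (rl_conv_comp n (1 - n) _ g x axb mg c1).
rewrite /abel_constant -/c -!mulrA; congr (_ * (_ * _)).
have ig : mu.-integrable `[a, x] (EFin \o g).
  apply: integrableS g1 => //; exact: subset_itvl.
have igo : mu.-integrable `[a, x[ (EFin \o g).
  by apply: integrableS ig => //; apply: subset_itvl; rewrite bnd_simp.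
(* The composed kernel is constant for [t < x] but 0 at [t = x], so the endpoint is removed before
   comparing integrands. *)
rewrite /prim -Rintegral_itv_bndo_bndc//.
rewrite -RintegralZl// Rintegral_mkcond; congr fine; apply: eq_integral => t _.
rewrite kernel_conv_inv// cE !patchE !mem_setE !in_itv/=.
have [tx|xt] := ltP t x; last by rewrite andbF mul0e.
rewrite (le_trans (ltW tx) xb) !andbT.
by case: ifPn => _ //; rewrite mule0.
Qed.

End fractional_integral.

(** * Continuous extension from [[a, b]] to the line by constants *)

Section clipped_extension.
Context {R : realType}.
Variables (a b : R).
Hypothesis ab : a <= b.

Definition clip (y : R) : R := Num.max a (Num.min b y).

Lemma clip_itv y : clip y \in `[a, b].
Proof. by rewrite in_itv/= le_max lexx ge_max ab ge_min lexx. Qed.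

Lemma clip_id y : a <= y <= b -> clip y = y.
Proof. by move=> /andP[ay yb]; rewrite /clip min_r// max_r. Qed.

Lemma clip_le y : y <= a -> clip y = a.
Proof. by move=> ya; rewrite /clip max_l// ge_min ya orbT. Qed.

Lemma continuous_clip : continuous clip.
Proof.
move=> y; apply: (@continuous_max R R (cst a) (fun y => Num.min b y)).
  exact: cst_continuous.
apply: (@continuous_min R R (cst b) id); first exact: cst_continuous.
by move=> U.
Qed.

Lemma continuous_comp_clip (F : R -> R) :
  {within `[a, b], continuous F} -> continuous (fun y => F (clip y)).
Proof.
move=> /subspace_continuousP cF y.
have cFy := cF (clip y) (clip_itv y).
apply: (@cvg_comp _ _ _ clip F _ _ _ _ cFy) => U /=; rewrite /within/= => nU.
have nU' : \forall z \near y, `[a, b]%classic (clip z) -> U (clip z).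
  exact: continuous_clip nU.
have nU2 : \forall z \near y, U (clip z).
  by apply: filterS nU' => z; apply; exact: clip_itv.
exact: nU2.
Qed.

Lemma within_continuous_bounded (F : R -> R) : {within `[a, b], continuous F} ->
  exists2 M, 0 <= M & forall x, a <= x <= b -> `|F x| <= M.
Proof.
move=> cF; have [c _ Fc] := EVT_max ab cF; have [d _ Fd] := EVT_min ab cF.
exists (`|F c| + `|F d|); first by rewrite addr_ge0.
move=> x xab; rewrite ler_norml; apply/andP; split.
  rewrite (le_trans _ (Fd x xab))// lerNl.
  by rewrite (le_trans (ler_norm _))// normrN lerDr.
by rewrite (le_trans (Fc x xab))// (le_trans (ler_norm _))// lerDl.
Qed.

End clipped_extension.

(** * Sup-norm bounds for the fractional integral *)

Section bounded_operand.
Context {R : realType}.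
Local Notation mu := (@lebesgue_measure R).
Variables (a b : R).
Hypothesis ab : a < b.

Let measurable_extend (f : R -> R) : measurable_fun `[a, b] f ->
  measurable_fun [set: R] (f \_ `[a, b]).
Proof. by move=> mf; apply/(measurable_restrictT _ (measurable_itv _)). Qed.

Let measurable_integrand m (f : R -> R) x : measurable_fun `[a, b] f ->
  measurable_fun [set: R] (fun s => kern m s * (f \_ `[a, b]) (x - s)).
Proof.
move=> mf; apply: measurable_funM; first exact: measurable_kern.
by apply: measurableT_comp; [exact: measurable_extend|exact: measurable_funB].
Qed.

(** The substitution [s = x - t] frees both the singular kernel and the domain from [x], as needed
    for a common dominating function. *)
Lemma rl_conv_reflect m (f : R -> R) x : measurable_fun `[a, b] f -> a <= x <= b ->
  rl_conv a m f x =
  \int[mu]_(s in `[0, b - a]) (kern m s * (f \_ `[a, b]) (x - s)).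
Proof.
move=> mf /andP[ax xb]; rewrite (rl_convE a b)// [RHS]Rintegral_mkcond /Rintegral.
apply: (congr1 fine); rewrite (integral_reflection x).
  apply: eq_integral => s _; congr EFin.
  rewrite !patchE !mem_setE !in_itv/= opprB addrCA subrr addr0.
  have [s0|s0] := leP 0 s => /=; last by rewrite kern_lt0 ?mul0r.
  have [//|sba] := leP s (b - a).
  rewrite leNgt (_ : x - s < a) ?mulr0//; lra.
apply/measurable_EFinP; apply: measurable_funM; last exact: measurable_extend.
by apply: measurableT_comp; [exact: measurable_kern|exact: measurable_funB].
Qed.

Variables (m : R) (f : R -> R) (M : R).
Hypothesis m0 : 0 < m.
Hypothesis mf : measurable_fun `[a, b] f.
Hypothesis fM : forall x, a <= x <= b -> `|f x| <= M.

Lemma integrable_kern : mu.-integrable `[0, b - a] (EFin \o kern m).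
Proof.
apply/integrableP; split.
  by apply/measurable_EFinP/measurable_funTS; exact: measurable_kern.
under eq_integral do rewrite /= ger0_norm ?kern_ge0//.
by rewrite integral_kern_lty// subr_gt0.
Qed.

Lemma integrable_scale_kern (c : R) :
  mu.-integrable `[0, b - a] (EFin \o (fun s => c * kern m s)).
Proof.
have := @integrableZl _ _ _ mu `[0, b - a] _ c (EFin \o kern m) integrable_kern.
by apply; exact: measurable_itv.
Qed.

Let bound_ge0 : 0 <= M.
Proof. by rewrite (le_trans _ (fM a _))// lexx ltW. Qed.

Let extend_le y : `|(f \_ `[a, b]) y| <= M.
Proof.
rewrite patchE mem_setE in_itv/=; case: ifP => [yab|_]; first exact: fM.
by rewrite normr0.
Qed.

Lemma integrable_rl_conv x : mu.-integrable `[0, b - a]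
  (EFin \o (fun s => kern m s * (f \_ `[a, b]) (x - s))).
Proof.
have iM := integrable_scale_kern M.
apply: le_integrable iM => //.
- by apply/measurable_EFinP/measurable_funTS; exact: measurable_integrand.
- move=> s _ /=; rewrite lee_fin !normrM mulrC ler_pM//.
  by rewrite (ger0_norm bound_ge0).
Qed.

Lemma normr_rl_conv_le x : a <= x <= b -> `|rl_conv a m f x| <= M * kern_mass a b m.
Proof.
move=> xab; rewrite rl_conv_reflect//.
apply: (le_trans (le_normr_Rintegral _ _)) => //; first exact: integrable_rl_conv.
rewrite /kern_mass -RintegralZl//; last exact: integrable_kern.
apply: le_Rintegral => //.
- exact: integrable_norm (integrable_rl_conv x).
- exact: integrable_scale_kern.
move=> s _; rewrite normrM mulrC ler_pM// ger0_norm ?kern_ge0//.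
Qed.

End bounded_operand.

(** * Linearity and continuity of the fractional integral *)

Section continuous_operand.
Context {R : realType}.
Local Notation mu := (@lebesgue_measure R).
Variables (a b : R).
Hypothesis ab : a < b.

Lemma within_continuous_measurable (F : R -> R) : {within `[a, b], continuous F} ->
  measurable_fun `[a, b] F.
Proof. by move=> cF; apply: subspace_continuous_measurable_fun. Qed.

Lemma rl_convB m (F G : R -> R) x : 0 < m -> a <= x <= b ->
  {within `[a, b], continuous F} -> {within `[a, b], continuous G} ->
  rl_conv a m (fun y => F y - G y) x = rl_conv a m F x - rl_conv a m G x.
Proof.
move=> m0 xab cF cG.
have [M _ FM] := within_continuous_bounded _ _ (ltW ab) _ cF.
have [N _ GN] := within_continuous_bounded _ _ (ltW ab) _ cG.
have mF := within_continuous_measurable _ cF.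
have mG := within_continuous_measurable _ cG.
rewrite !(rl_conv_reflect a b)//; last exact: measurable_funB.
rewrite -RintegralB//; last 2 first.
- exact: (integrable_rl_conv a b ab m F M).
- exact: (integrable_rl_conv a b ab m G N).
apply: eq_Rintegral => s _; rewrite !patchE; case: ifP => _; first by rewrite mulrBr.
by rewrite mulr0 subrr.
Qed.

(** Continuity under the integral sign, dominated by [M * kern m], for the extension of [F] by
    constants. *)
Lemma rl_conv_continuous m (F : R -> R) : 0 < m -> C0 a b F ->
  {within `[a, b], continuous (rl_conv a m F)}.
Proof.
move=> m0 [cF Fa].
have [M M0 FM] := within_continuous_bounded _ _ (ltW ab) _ cF.
have mF := within_continuous_measurable _ cF.
pose f x s := kern m s * F (clip a b (x - s)).
have cFc := continuous_comp_clip _ _ (ltW ab) _ cF.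
have mf x : measurable_fun [set: R] (f x).
  apply: measurable_funM; first exact: measurable_kern.
  apply: (measurableT_comp (continuous_measurable_fun cFc)).
  exact: measurable_funB.
have fM x s : `|f x s| <= M * kern m s.
  rewrite normrM mulrC ler_pM//; last by rewrite ger0_norm ?kern_ge0.
  exact/FM/clip_itv/ltW.
have iM : mu.-integrable `[0, b - a] (EFin \o (fun s => M * kern m s)).
  exact: integrable_scale_kern.
(* An open interval around [[a, b]], so that the endpoints need no one-sided argument. *)
have cG : {in `]a - 1, b + 1[%classic,
    continuous (fun x => \int[mu]_(s in `[0, b - a]) f x s)}.
  apply: (@continuity_under_integral _ _ _ mu f _ _ _ _ _ _ _ iM) => //.
  - move=> x _; apply: le_integrable iM => //.
      by apply/measurable_EFinP/measurable_funTS; exact: mf.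
    move=> s _ /=; rewrite lee_fin (le_trans (fM x s))// ler_norm//.
  - apply: aeW => s _ x _; apply: cvgM; first exact: cvg_cst.
    apply: (@continuous_comp _ _ _ (fun y => y - s) (fun y => F (clip a b y))).
      by apply: cvgB; [exact: cvg_id|exact: cvg_cst].
    exact: cFc.
  - by move=> x _; apply: aeW => s _.
have GE x : a <= x <= b ->
    \int[mu]_(s in `[0, b - a]) f x s = rl_conv a m F x.
  move=> /[dup] xab /andP[ax xb]; rewrite (rl_conv_reflect a b)//.
  apply: eq_Rintegral => s; rewrite inE/= in_itv/= => /andP[s0 sba].
  rewrite /f patchE mem_setE in_itv/=; have [axs|xsa] := leP a (x - s) => /=.
    have xsb : x - s <= b by lra.
    by rewrite xsb clip_id// axs.
  (* [F a = 0] makes the constant extension below [a] agree with the extension by zero. *)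
  by rewrite (clip_le a b)// ?ltW// Fa.
apply/subspace_continuousP => x xab.
have xI : x \in `]a - 1, b + 1[%classic.
  by move: xab; rewrite inE/= !in_itv/= => /andP[ax xb]; lra.
have cGx : (fun y => \int[mu]_(s in `[0, b - a]) f y s) y @[y --> x] -->
    rl_conv a m F x.
  by rewrite -GE; [exact: cG|exact: xab].
have e : {near within `[a, b] (nbhs x),
    (fun y => \int[mu]_(s in `[0, b - a]) f y s) =1 rl_conv a m F}.
  by near=> y; apply: GE; near: y; exact: withinT.
apply: (cvg_trans (near_eq_cvg e)); exact: cvg_within_filter cGx.
Unshelve. all: by end_near. Qed.

End continuous_operand.

(** * Order properties of the Alexiewicz norm *)

Section Alexiewicz.
Context {R : realType}.
Variables (a b : R).
Hypothesis ab : a <= b.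

Lemma alex_le (D : R -> R) (M : R) :
  (forall x, a <= x <= b -> `|D x| <= M) -> alex a b D <= M.
Proof.
move=> DM; apply: ge_sup; first by exists `|D a|, a => //=; rewrite in_itv/= lexx.
by move=> _ [x /= xab <-]; exact: DM.
Qed.

(** The bound [M] guarantees that [sup] is a true supremum and not a default value. *)
Lemma le_alex (D : R -> R) (M : R) x : (forall x, a <= x <= b -> `|D x| <= M) ->
  a <= x <= b -> `|D x| <= alex a b D.
Proof.
move=> DM xab; apply: ub_le_sup; last by exists x.
by exists M => _ [y /= yab <-]; exact: DM.
Qed.

Lemma alex_ge0 (D : R -> R) (M : R) : (forall x, a <= x <= b -> `|D x| <= M) ->
  0 <= alex a b D.
Proof.
by move=> DM; apply: (le_trans (normr_ge0 (D a))); apply: (le_alex _ M) => //; rewrite lexx.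
Qed.

Lemma eq_alex (D E : R -> R) : (forall x, a <= x <= b -> D x = E x) ->
  alex a b D = alex a b E.
Proof.
by move=> DE; congr sup; apply: eq_imagel => x /= xab; rewrite DE.
Qed.

End Alexiewicz.

(** * Density of integrable functions in the Alexiewicz norm *)

Section density.
Context {R : realType}.
Local Notation mu := (@lebesgue_measure R).
Variables (a b : R) (F : R -> R).
Hypothesis ab : a < b.
Hypothesis F0 : C0 a b F.

(* F is approximated by the moving averages of its continuous extension over
   [x - step k, x], which are the primitives of difference quotients. *)
Let Fc (y : R) : R := F (clip a b y).
Let step (k : nat) : R := k.+2%:R^-1.

Let cFc : continuous Fc. Proof. exact: continuous_comp_clip (ltW ab) _ F0.1. Qed.

Let Fc_le y : y <= a -> Fc y = 0.
Proof. by move=> ya; rewrite /Fc (clip_le a b)// F0.2. Qed.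

Let step_gt0 k : 0 < step k. Proof. by rewrite invr_gt0. Qed.

Let step_lt1 k : step k < 1. Proof. by rewrite invf_lt1// ltr1n. Qed.

(** The base point [a - 1] lies to the left of every [x - step k] with [a <= x], because
    [step k < 1]; [Psi] is thus differentiable at all points used. [Fc] is 0 on the added piece. *)
Let Psi (x : R) : R := \int[mu]_(t in `[a - 1, x]) Fc t.

Let continuous_integrable (g : R -> R) p q : continuous g ->
  mu.-integrable `[p, q] (EFin \o g).
Proof.
move=> cg; apply: continuous_compact_integrable; first exact: segment_compact.
by apply: continuous_subspaceT.
Qed.

Let Psi_derive x : a - 1 < x -> is_derive x 1 Psi (Fc x).
Proof.
move=> ax; have x1 : x < x + 1 by rewrite ltrDl.
have [dPsi PsiE] := continuous_FTC1_closed x1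
  (continuous_integrable Fc (a - 1) (x + 1) cFc) ax (cFc x).
by split; [exact: dPsi|rewrite -derive1E; exact: PsiE].
Qed.

Let Psi_le x : x <= a -> Psi x = 0.
Proof.
move=> xa; rewrite /Psi /Rintegral integral0_eq// => t /=; rewrite in_itv/= => /andP[_ tx].
by rewrite Fc_le// (le_trans tx).
Qed.

Let quotient (k : nat) (x : R) : R := (Psi x - Psi (x - step k)) / step k.

Let diff_quotient (k : nat) (x : R) : R := (Fc x - Fc (x - step k)) / step k.

Let quotient_derive k x : a - 1 + step k < x ->
  is_derive x 1 (quotient k) (diff_quotient k x).
Proof.
move=> ax; have ax1 : a - 1 < x by rewrite (lt_trans _ ax)// ltrDl.
have ax2 : a - 1 < x - step k by rewrite ltrBrDr.
have d1 := Psi_derive x ax1.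
have d2 := Psi_derive (x - step k) ax2.
have d3 : is_derive x 1 (Psi \o (shift (- step k))) (Fc (x - step k) * 1).
  by apply: is_derive1_comp; exact: is_derive_shift.
have -> : diff_quotient k x = (step k)^-1 *: (Fc x - Fc (x - step k) * 1).
  by rewrite /diff_quotient mulr1 mulrC.
have -> : quotient k = (step k)^-1 *: (Psi - (Psi \o (shift (- step k)))).
  by apply/funext => y; rewrite /quotient mulrC.
by apply: is_deriveZ.
Qed.

Let continuous_diff_quotient k : continuous (diff_quotient k).
Proof.
move=> x; apply: cvgM; last exact: cvg_cst.
apply: cvgB; first exact: cFc.
apply: (@continuous_comp _ _ _ (fun y => y - step k) Fc); last exact: cFc.
by apply: cvgB; [exact: cvg_id|exact: cvg_cst].
Qed.

(** The fundamental theorem for [quotient k], whose value at [a] is 0 because [Psi] vanishes up to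
    [a]. *)
Let prim_diff_quotient k x : a <= x -> prim a (diff_quotient k) x = quotient k x.
Proof.
have Qa : quotient k a = 0.
  by rewrite /quotient !Psi_le ?subrr ?mul0r// gerBl ltW.
rewrite le_eqVlt => /predU1P[<-|ax].
  by rewrite Qa /prim set_itv1 Rintegral_set1.
have Qd y : a <= y -> is_derive y 1 (quotient k) (diff_quotient k y).
  move=> ay; apply: quotient_derive; rewrite (lt_le_trans _ ay)//.
  by rewrite -addrA gtrDl addrC subr_lt0.
have Qc y : a <= y -> {for y, continuous (quotient k)}.
  by move=> /Qd[dQ _]; exact/differentiable_continuous/derivable1_diffP.
rewrite /prim /Rintegral (@continuous_FTC2 _ (diff_quotient k) (quotient k))//=.
- by rewrite Qa subr0.
- by apply: continuous_subspaceT; exact: continuous_diff_quotient.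
- split.
  + by move=> y; rewrite in_itv/= => /andP[ay _]; case: (Qd y (ltW ay)).
  + by apply: cvg_at_right_filter; exact: Qc.
  + by apply: cvg_at_left_filter; apply: Qc; exact: ltW.
- move=> y; rewrite in_itv/= => /andP[ay _]; rewrite derive1E.
  by case: (Qd y (ltW ay)).
Qed.

Let quotient_mean k x : a <= x ->
  exists2 c, x - step k <= c <= x & quotient k x = Fc c.
Proof.
move=> ax; have sx : x - step k <= x by rewrite gerBl ltW.
have asx : a - 1 < x - step k.
  by rewrite ltrBrDr (lt_le_trans _ ax)// -addrA gtrDl addrC subr_lt0.
have [c cx cE] : exists2 c, c \in `[x - step k, x] &
    Psi x - Psi (x - step k) = Fc c * (x - (x - step k)).
  apply: MVT_segment => //.
    by move=> y; rewrite in_itv/= => /andP[sy _]; apply: Psi_derive; exact: lt_trans sy.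
  apply: continuous_in_subspaceT => y; rewrite inE/= in_itv/= => /andP[sy _].
  have [dP _] := Psi_derive y (lt_le_trans asx sy).
  exact/differentiable_continuous/derivable1_diffP.
exists c; first by move: cx; rewrite in_itv.
by rewrite /quotient cE opprB addrCA subrr addr0 mulfK// gt_eqF.
Qed.

Let step_small (e : R) : 0 < e -> \forall k \near \oo, step k < e.
Proof.
move=> e0; near=> k; rewrite /step invf_plt ?posrE//.
have ek : e^-1 < k%:R by near: k; exact: nbhs_infty_gtr.
by rewrite (lt_le_trans ek)// ler_nat -addn2 leq_addr.
Unshelve. all: by end_near. Qed.

Let uniformly_close (e : R) : 0 < e -> \forall k \near \oo,
  forall x, a <= x <= b -> forall c, x - step k <= c <= x -> `|Fc c - Fc x| <= e.
Proof.
move=> e0.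
pose P (k : nat) (x : R) := forall c, x - step k <= c <= x -> `|Fc c - Fc x| <= e.
have /compact_near_coveringP cab : compact (`[a, b] : set R) by exact: segment_compact.
apply: (cab nat \oo P) => x _.
have /cvgrPdist_lt/(_ (e / 2)) := cFc x; rewrite divr_gt0// => /(_ isT)[d /= d0 dF].
(* [y] is taken within [d / 2] of [x] and [c] within [d / 2] of [y], so continuity at [x] controls
   both. *)
have d20 : 0 < d / 2 by rewrite divr_gt0.
exists (ball x (d / 2), [set k | step k < d / 2]).
  by split => /=; [exact: nbhsx_ballx|exact: step_small].
move=> [y k] [/= xy kd] c /andP[yc cy].
have Fy : `|Fc x - Fc y| < e / 2.
  by apply: dF; apply: lt_trans xy _; rewrite ltr_pdivrMr// ltr_pMr// ltr1n.
have Fcc : `|Fc x - Fc c| < e / 2.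
  apply: dF => /=; rewrite /ball_/=.
  rewrite (_ : x - c = (x - y) + (y - c)); last by ring.
  rewrite (le_lt_trans (ler_normD _ _))// [ltRHS]splitr ltrD//.
  by rewrite ger0_norm ?subr_ge0// (le_lt_trans _ kd)// lerBlDr -lerBlDl.
rewrite (_ : Fc c - Fc y = (Fc x - Fc y) - (Fc x - Fc c)); last by ring.
by rewrite (le_trans (ler_normB _ _))// [leRHS]splitr ltW// ltrD.
Qed.

Lemma C0_approximation : exists fk : nat -> R -> R,
  (forall k, L1 a b (fk k)) /\
  (fun k => alex a b (fun x => prim a (fk k) x - F x)) @ \oo --> (0 : R).
Proof.
exists diff_quotient; split.
  by move=> k; apply: continuous_integrable; exact: continuous_diff_quotient.
apply/cvgrPdist_le => e e0.
near=> k.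
have close : forall x, a <= x <= b -> `|prim a (diff_quotient k) x - F x| <= e.
  move=> x /[dup] xab /andP[ax xb]; rewrite prim_diff_quotient//.
  have [c cx ->] := quotient_mean k x ax.
  have -> : F x = Fc x by rewrite /Fc clip_id.
  by move: c cx; move: x xab {ax xb}; near: k; exact: uniformly_close.
rewrite sub0r normrN ger0_norm; first exact: alex_le (ltW ab) _ _ close.
exact: alex_ge0 (ltW ab) _ _ close.
Unshelve. all: by end_near. Qed.

End density.

(** * From distributions to pointwise identities between primitives *)

Section characterization.
Context {R : realType}.
Local Notation mu := (@lebesgue_measure R).
Variables (a b : R).
Hypothesis ab : a < b.

Let lab : a <= b. Proof. exact: ltW. Qed.

Lemma continuous_L1 (F : R -> R) : {within `[a, b], continuous F} -> L1 a b F.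
Proof. by move=> cF; apply: continuous_compact_integrable => //; exact: segment_compact. Qed.

Lemma C0_prim (g : R -> R) : L1 a b g -> C0 a b (prim a g).
Proof.
move=> ig; split; first exact: parameterized_integral_continuous lab ig.
by rewrite /prim set_itv1 Rintegral_set1.
Qed.

Lemma rl_convZ (m c : R) (F : R -> R) x : 0 < m -> a <= x <= b ->
  {within `[a, b], continuous F} ->
  rl_conv a m (fun y => c * F y) x = c * rl_conv a m F x.
Proof.
move=> m0 xab cF.
have [M _ FM] := within_continuous_bounded _ _ lab _ cF.
have mF := within_continuous_measurable _ _ _ cF.
rewrite !(rl_conv_reflect a b)//; last exact: measurable_funM.
rewrite -RintegralZl//; last exact: (integrable_rl_conv a b ab m F M).
apply: eq_Rintegral => s _; rewrite !patchE; case: ifP => _; first by rewrite mulrCA.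
by rewrite !mulr0.
Qed.

Lemma eq_RLint (m : R) (F G : R -> R) x : x <= b ->
  (forall y, a <= y <= b -> F y = G y) -> RLint a m F x = RLint a m G x.
Proof.
move=> xb FG; congr (_ * _); apply: eq_Rintegral => t; rewrite inE/= in_itv/=.
by move=> /andP[at_ tx]; rewrite FG// at_ (le_trans tx).
Qed.

Lemma prim_RLint_approximation (m : R) (F : R -> R) (fk : nat -> R -> R) :
  0 < m < 1 -> C0 a b F -> (forall k, L1 a b (fk k)) ->
  (fun k => alex a b (fun x => prim a (fk k) x - F x)) @ \oo --> (0 : R) ->
  (fun k => alex a b (fun x => prim a (RLint a m (fk k)) x - RLint a m F x))
    @ \oo --> (0 : R).
Proof.
move=> m01 F0 ifk fkF; have m0 : 0 < m by case/andP: m01.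
have Gm0 := Gamma_gt0 _ m01.
have cP k := (C0_prim _ (ifk k)).1.
pose u k := alex a b (fun x => prim a (fk k) x - F x).
pose C := (Gamma m)^-1 * kern_mass a b m.
(* I^1 I^m (f_k) - I^m F = I^m (I^1 f_k - F) *)
have bound k x : a <= x <= b ->
    `|prim a (RLint a m (fk k)) x - RLint a m F x| <= u k * C.
  move=> xab; rewrite (prim_RLint a b)// /RLint -!/(rl_conv a m _ x) -mulrBr.
  rewrite -(rl_convB a b)//; last exact: F0.1.
  rewrite normrM gtr0_norm ?invr_gt0// mulrCA ler_pM2l ?invr_gt0//.
  have cD : {within `[a, b], continuous (fun y => prim a (fk k) y - F y)}.
    by move=> y; apply: continuousB; [exact: cP|exact: F0.1].
  (* [M] only ensures that the Alexiewicz norm bounds the difference pointwise; the estimate itself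
     uses [u k]. *)
  have [M _ DM] := within_continuous_bounded _ _ lab _ cD.
  apply: normr_rl_conv_le => //; first exact: within_continuous_measurable.
  by move=> y yab; exact: le_alex DM yab.
apply: (@squeeze_cvgr _ _ _ _ (cst 0) (fun k => u k * C)).
- apply: nearW => k; rewrite (alex_ge0 _ _ lab _ _ (bound k))/=.
  exact: alex_le (bound k).
- exact: cvg_cst.
- by rewrite -(mul0r C); apply: cvgM => //; exact: cvg_cst.
Qed.

(** Given [RL_frac], the sequence of [C0_approximation] has images whose primitives tend to both [G]
    and [RLint a m F], and limits are unique. Conversely, the approximation estimate covers every
    admissible sequence. *)
Lemma RL_fracP (m : R) (F G : R -> R) : 0 < m < 1 -> C0 a b F -> C0 a b G ->
  RL_frac a b m F G <-> forall x, a <= x <= b -> G x = RLint a m F x.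
Proof.
move=> m01 F0 G0; have m0 : 0 < m by case/andP: m01.
split=> [[_ FG] x xab|GE]; last first.
  split=> // fk ifk fkF; under eq_fun => k.
    rewrite (eq_alex _ _ _ (fun x => prim a (RLint a m (fk k)) x - RLint a m F x)); last first.
      by move=> x xab; rewrite GE.
    over.
  exact: prim_RLint_approximation.
have [fk [ifk fkF]] := C0_approximation a b F ab F0.
have fkG := FG fk ifk fkF.
have fkI := prim_RLint_approximation m F fk m01 F0 ifk fkF.
have bounded_conv (f : R -> R) : C0 a b f -> exists M, forall y, a <= y <= b ->
    `|RLint a m f y| <= M.
  move=> [cf _]; have [M _ fM] := within_continuous_bounded _ _ lab _ cf.
  exists (`|(Gamma m)^-1| * (M * kern_mass a b m)) => y yab.
  rewrite normrM ler_wpM2l//; apply: normr_rl_conv_le => //.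
  exact: within_continuous_measurable.
have pointwise (H : R -> R) M : (forall y, a <= y <= b -> `|H y| <= M) ->
    (fun k => alex a b (fun x => prim a (RLint a m (fk k)) x - H x)) @ \oo --> (0 : R) ->
    (fun k => prim a (RLint a m (fk k)) x) @ \oo --> H x.
  move=> HM /cvgrPdist_le fkH; apply/cvgrPdist_le => e e0.
  near=> k; rewrite distrC.
  have [N fN] := bounded_conv _ (C0_prim _ (ifk k)).
  have bD y : a <= y <= b -> `|prim a (RLint a m (fk k)) y - H y| <= N + M.
    move=> yab; rewrite (le_trans (ler_normB _ _))// lerD ?HM//.
    by rewrite (prim_RLint a b)// fN.
  apply: (le_trans (le_alex _ _ _ _ _ bD xab)).
  rewrite (le_trans (ler_norm _))// -normrN -[X in `|X|]add0r.
  by near: k; exact: fkH.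
have [M _ GM] := within_continuous_bounded _ _ lab _ G0.1.
have [N FN] := bounded_conv _ F0.
exact: cvg_unique (pointwise G M GM fkG) (pointwise _ N FN fkI).
Unshelve. all: by end_near. Qed.

(** Differentiation settles interior points, [C0] contains the value at [a], and [b] follows by a
    left limit. *)
Lemma prim_eq0 (D : R -> R) : C0 a b D ->
  (forall x, a <= x <= b -> prim a D x = 0) -> forall x, a <= x <= b -> D x = 0.
Proof.
move=> [cD Da] pD.
pose Dc y := D (clip a b y).
have cDc : continuous Dc by exact: continuous_comp_clip lab _ cD.
have inner x : a < x < b -> Dc x = 0.
  move=> /andP[ax xb].
  have iDc : mu.-integrable `[a, b] (EFin \o Dc).
    apply: continuous_compact_integrable; first exact: segment_compact.
    exact: continuous_subspaceT.
  have [_ <-] := continuous_FTC1_closed xb iDc ax (cDc x).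
  (* Near [x] the integral of [Dc] from [a] is [prim a D], which is 0. *)
  rewrite derive1E (@near_eq_derive _ _ _ _ (cst 0)) ?derive_cst//.
  near=> y.
  have yab : a <= y <= b.
    by apply/andP; split; near: y; [exact: lt_le_nbhsr|exact: lt_le_nbhsl].
  rewrite -[RHS](pD y yab); apply: eq_Rintegral => t; rewrite inE/= in_itv/=.
  move=> /andP[at_ ty]; rewrite /Dc clip_id// at_ (le_trans ty)//.
  by case/andP: yab.
have Db : Dc b = 0.
  have cb : Dc y @[y --> b^'-] --> Dc b by apply: cvg_at_left_filter; exact: cDc.
  apply: (cvg_unique _ cb) => //.
  apply: (cvg_trans _ (cvg_cst 0 : cst 0 y @[y --> b^'-] --> (0 : R))).
  apply: near_eq_cvg; near=> y; rewrite inner//; apply/andP; split.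
    by near: y; exact: nbhs_left_gt.
  by near: y; exact: nbhs_left_lt.
move=> x /[dup] xab /andP[ax xb].
move: ax; rewrite le_eqVlt => /predU1P[<-//|ax].
have -> : D x = Dc x by rewrite /Dc clip_id.
by move: xb; rewrite le_eqVlt => /predU1P[->//|xb]; rewrite inner// ax.
Unshelve. all: by end_near. Qed.

End characterization.

(** Since [J^(1-n) f] is a priori a distribution, its being the continuous function [h] is expressed
    by its primitive being [prim a h]. *)
Theorem theorem5p1 (R : realType) (a b : R) (hab : a < b)
  (n : R) (hn0 : 0 < n) (hn1 : n < 1)
  (F : R -> R) (hF : C0 a b F) :
  (exists Phi : R -> R, C0 a b Phi /\ RL_frac a b n Phi F) <->
  (exists h : R -> R, {within `[a, b], continuous h} /\ h a = 0 /\
      RL_frac a b (1 - n) F (prim a h)).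
Proof.
have n01 : 0 < n < 1 by rewrite hn0.
have n01' : 0 < 1 - n < 1 by rewrite subr_gt0 hn1 ltrBlDr ltrDl.
have scale_C0 c (G : R -> R) : C0 a b G -> C0 a b (fun y => c * G y).
  move=> [cG Ga]; split; last by rewrite Ga mulr0.
  by move=> y; apply: cvgM; [exact: cvg_cst|exact: cG].
have scaled_prim c (G : R -> R) x : C0 a b G -> a <= x <= b ->
    prim a (fun y => c * G y) x = c * prim a G x.
  by move=> [cG _] xab; rewrite !prim_rl_conv (rl_convZ a b).
split.
- move=> [Phi [Phi0 /(RL_fracP a b hab n Phi F n01 Phi0 hF) FE]].
  (* The outer order is [1 - n] and the inner one [n = 1 - (1 - n)], so the constant is the one for
     [1 - n]. *)
  pose c := abel_constant (1 - n).
  have h0 := scale_C0 c Phi Phi0.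
  exists (fun y => c * Phi y); split; first exact: h0.1.
  split; first exact: h0.2.
  apply/(RL_fracP a b hab _ _ _ n01' hF (C0_prim a b hab _ (continuous_L1 a b _ h0.1))).
  move=> x /[dup] xab /andP[ax xb].
  rewrite scaled_prim// -(RLint_RLint a b)//; last exact: continuous_L1 Phi0.1.
  by rewrite opprB addrCA subrr addr0; apply/esym/(eq_RLint a b).
- move=> [h [ch [ha]]].
  have h0 : C0 a b h by [].
  have ih := continuous_L1 a b _ ch.
  move=> /(RL_fracP a b hab _ _ _ n01' hF (C0_prim a b hab _ ih)) hE.
  pose c := abel_constant n.
  have c0 : c != 0 by rewrite gt_eqF// abel_constant_gt0.
  have Phi0 := scale_C0 c^-1 h h0.
  exists (fun y => c^-1 * h y); split => //.
  apply/(RL_fracP a b hab _ _ _ n01 Phi0 hF).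
  (* Both terms are continuous and vanish at [a], so it suffices that they have the same
     primitive. *)
  pose D y := F y - RLint a n (fun y => c^-1 * h y) y.
  have cI : {within `[a, b], continuous (RLint a n (fun y => c^-1 * h y))}.
    move=> y; apply: cvgM; first exact: cvg_cst.
    exact: (rl_conv_continuous a b hab n _ hn0 Phi0).
  have D0 : C0 a b D.
    split; first by move=> y; apply: continuousB; [exact: hF.1|exact: cI].
    by rewrite /D hF.2 /RLint set_itv1 Rintegral_set1 mulr0 subrr.
  suff D_eq0 x : a <= x <= b -> D x = 0.
    by move=> x xab; apply/eqP; rewrite -subr_eq0 -/(D x) D_eq0.
  apply: (prim_eq0 a b hab D D0) => {}x /[dup] xab /andP[ax xb].
  rewrite prim_rl_conv (rl_convB a b)//; last exact: hF.1.
  rewrite -!prim_rl_conv (prim_RLint a b)//; last exact: continuous_L1 Phi0.1.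
  rewrite (eq_RLint a b _ _ (fun y => c^-1 * prim a h y))//; last first.
    by move=> y yab; rewrite scaled_prim.
  have ch' := (C0_prim a b hab _ ih).1.
  rewrite /RLint -/(rl_conv a n _ x) (rl_convZ a b)// mulrCA.
  rewrite -[(Gamma n)^-1 * _]/(RLint a n (prim a h) x).
  rewrite (eq_RLint a b _ _ _ _ xb hE) (RLint_RLint a b)//.
    by rewrite mulKf// subrr.
  exact: continuous_L1 hF.1.
Qed.
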